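(* Let $d\ge 1$ and let $A$ be a $d\times d$ matrix with real entries. Then $A$ is left stochastic if and only if $A$ is a convex combination of $d\times d$ Permutation-Like Matrices, i.e. if and only if there exist $m\ge 1$, real numbers $\lambda_1,\dots,\lambda_m\in[0,1]$ with $\sum_{i=1}^m\lambda_i=1$, and $P_1,\dots,P_m\in PL_d$ such that $A=\sum_{i=1}^m\lambda_iP_i$.
   Context: A $d\times d$ matrix is a Permutation-Like Matrix (PLM) if all its entries are $0$ or $1$ and each column contains exactly one entry equal to $1$; $PL_d$ denotes the set of all $d\times d$ PLM. A matrix $A=(a_{i,j})$ with non-negative entries is left stochastic if $\sum_{i=1}^d a_{i,j}=1$ for every $1\le j\le d$. *)

(* Defs.v *)
From mathcomp Require Import all_boot all_order all_algebra.
From mathcomp Require Import reals.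

Set Implicit Arguments.
Unset Strict Implicit.
Unset Printing Implicit Defensive.

Import Order.TTheory GRing.Theory Num.Theory.

Local Open Scope ring_scope.

(* Membership in PL_d. *)
Definition is_PLM (R : realType) (d : nat) (P : 'M[R]_d) : Prop :=
  (forall i j : 'I_d, P i j = 0 \/ P i j = 1) /\
  (forall j : 'I_d, exists! i : 'I_d, P i j = 1).

Definition left_stochastic (R : realType) (d : nat) (A : 'M[R]_d) : Prop :=
  (forall i j : 'I_d, 0 <= A i j) /\
  (forall j : 'I_d, \sum_(i < d) A i j = 1).

(* Main.v *)
Require Import Defs.
From mathcomp Require Import all_boot all_order all_algebra.
From mathcomp Require Import reals.

(* If [f j] is drawn with probability [A (f j) j], independently for each
   column [j], then the entry [(i, j)] of the random PLM of [f] has mean [A i j].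
   So the PLM of [f], with weight the product of the [A (f j) j] over [j],
   gives the convex combination, [f] ranging over all self-maps of the index
   set. *)

Import Order.TTheory GRing.Theory Num.Theory.

Local Open Scope ring_scope.

Definition map_PLM {R : realType} {d : nat} (f : {ffun 'I_d -> 'I_d}) : 'M[R]_d :=
  \matrix_(i, j) (f j == i)%:R.

Definition map_weight {R : realType} {d : nat} (A : 'M[R]_d)
    (f : {ffun 'I_d -> 'I_d}) : R :=
  \prod_j A (f j) j.

Lemma map_PLM_is_PLM (R : realType) (d : nat) (f : {ffun 'I_d -> 'I_d}) :
  is_PLM (map_PLM f : 'M[R]_d).
Proof.
split=> [i j|j]; first by rewrite mxE; case: (f j == i); [right | left].
exists (f j); split=> [|i]; rewrite mxE ?eqxx //.
by case: eqP => // _ /eqP; rewrite eq_sym oner_eq0.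
Qed.

Lemma is_PLM_left_stochastic (R : realType) (d : nat) (P : 'M[R]_d) :
  is_PLM P -> left_stochastic P.
Proof.
case=> P01 P1; split=> [i j|j]; first by case: (P01 i j) => ->.
have [i [Pij i_uniq]] := P1 j.
rewrite (bigD1 i) //= Pij big1 ?addr0 // => k /eqP k_neq_i.
by case: (P01 k j) => // /i_uniq /esym.
Qed.

(** Picking one term from each column sum amounts to picking [f], so this sum is the expanded
    product of the column sums, all equal to 1. *)
Lemma sum_map_weight (R : realType) (d : nat) (A : 'M[R]_d) :
  left_stochastic A -> \sum_f map_weight A f = 1.
Proof.
by case=> _ A1; rewrite -(bigA_distr_bigA (fun j i => A i j)) big1.
Qed.

Lemma sum_map_weight_PLM (R : realType) (d : nat) (A : 'M[R]_d) :
  left_stochastic A -> \sum_f map_weight A f *: map_PLM f = A.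
Proof.
case=> _ A1; apply/matrixP=> i j; rewrite summxE.
(* The indicator of [f j = i] is absorbed into the factor of column [j], so
   that the sum over [f] still factors over the columns. *)
pose F k l := A l k * ((k == j) ==> (l == i))%:R.
transitivity (\sum_(f : {ffun 'I_d -> 'I_d}) \prod_k F k (f k)).
  apply: eq_bigr => f _; rewrite !mxE big_split /=; congr (_ * _).
  by rewrite (bigD1 j) //= eqxx big1 ?mulr1 // => k /negbTE ->.
(* In column [j] the indicator leaves only the term [A i j]; every other column contributes its full
   sum, which is 1. *)
rewrite -bigA_distr_bigA (bigD1 j) //= [X in _ * X]big1 ?mulr1.
  rewrite (bigD1 i) //= /F !eqxx mulr1 big1 ?addr0 // => l /negbTE ->.
  by rewrite mulr0.
move=> k /negbTE k_neq_j; rewrite -[RHS](A1 k); apply: eq_bigr => l _.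
by rewrite /F k_neq_j mulr1.
Qed.

Lemma left_stochastic_le1 (R : realType) (d : nat) (A : 'M[R]_d) i j :
  left_stochastic A -> A i j <= 1.
Proof.
by case=> A0 A1; rewrite -(A1 j) (bigD1 i) //= lerDl sumr_ge0.
Qed.

(** This gives the converse direction, since each PLM is itself left stochastic. Exchanging the two
    sums reduces a column sum of the combination to the sum of the [lambda k]. *)
Lemma left_stochastic_convex (R : realType) (d m : nat) (lambda : 'I_m -> R)
    (P : 'I_m -> 'M[R]_d) :
  (forall k, 0 <= lambda k) -> \sum_k lambda k = 1 ->
  (forall k, left_stochastic (P k)) ->
  left_stochastic (\sum_k lambda k *: P k).
Proof.
move=> l0 l1 PS; split=> [i j|j].
  rewrite summxE sumr_ge0 // => k _; rewrite mxE mulr_ge0 //.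
  by case: (PS k).
under eq_bigr do rewrite summxE.
rewrite exchange_big -[RHS]l1; apply: eq_bigr => k _.
under eq_bigr do rewrite mxE.
by case: (PS k) => _ P1; rewrite -mulr_sumr P1 mulr1.
Qed.

Theorem theorem4p11 (R : realType) (d : nat) (hd : (1 <= d)%N) (A : 'M[R]_d) :
  left_stochastic A <->
  exists (m : nat) (lambda : 'I_m -> R) (P : 'I_m -> 'M[R]_d),
    [/\ (1 <= m)%N,
        forall i : 'I_m, 0 <= lambda i <= 1,
        \sum_(i < m) lambda i = 1,
        forall i : 'I_m, is_PLM (P i) &
        A = \sum_(i < m) lambda i *: P i].
Proof.
split=> [AS|[m [lambda [P [_ l01 l1 PP ->]]]]]; last first.
  apply: left_stochastic_convex => // k; first by case/andP: (l01 k).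
  exact: is_PLM_left_stochastic.
(* The self-maps are numbered by [enum_val], since the combination must be indexed by an ordinal
   type. *)
exists #|{ffun 'I_d -> 'I_d}|, (fun k => map_weight A (enum_val k)),
  (fun k => map_PLM (enum_val k)); split.
(* The identity map shows that there is at least one term. *)
- by apply/card_gt0P; exists [ffun j => j].
- move=> k; have [A0 _] := AS; apply/andP; split; first exact: prodr_ge0.
  by apply: prodr_ile1 => j _; rewrite A0 left_stochastic_le1.
- by rewrite -(big_enum_val (map_weight A)) -[RHS](sum_map_weight _ _ _ AS).
- by move=> k; apply: map_PLM_is_PLM.
- rewrite -(big_enum_val (fun f => map_weight A f *: map_PLM f)).
  by rewrite -[LHS](sum_map_weight_PLM _ _ _ AS).
Qed.
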